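(* Let $P$ be an arbitrary (not necessarily finite) poset and let $A=(a_i)_{i\in I}$ be a well sequence in $P$. Then the associated choice function $f_A$ is conservative.
   Context: An (order) ideal of a poset $P$ is a subset $X\subseteq P$ such that $x\in X$, $y\le x$ imply $y\in X$; $\mathcal I(P)$ is the set of all ideals (including $\emptyset$ and $P$). For $S\subseteq P$, $I(S)=\{y\in P : y\le s\text{ for some }s\in S\}$ is the ideal generated by $S$. A choice function (CF) on $P$ is a map $f:\mathcal I(P)\to\mathcal I(P)$ with $f(X)\subseteq X$ for every ideal $X$. It has the heredity property if for all ideals $A\subseteq B$ one has $f(B)\cap A\subseteq f(A)$. It has the outcast property if for all ideals $A,B$ with $f(B)\subseteq A\subseteq B$ one has $f(A)=f(B)$. A CF is conservative if it has both the heredity and the outcast properties. A well sequence in $P$ is a family $A=(a_i)_{i\in I}$ of elements of $P$ indexed by a (possibly empty) well-ordered set $(I,\prec)$. The elementary CF $f_A$ associated with $A$ is defined as follows: for an ideal $X$, if there is $i\in I$ with $a_i\in X$, let $i$ be the $\prec$-least such index and put $f_A(X)=X\cap I(\{a_j : j\preceq i\})$; if no $a_i$ belongs to $X$, put $f_A(X)=X\cap I(\{a_j: j\in I\})$. *)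

(* Defs.v *)
From mathcomp Require Import all_boot all_order.
From mathcomp Require Import boolp classical_sets wochoice.

Set Implicit Arguments.
Unset Strict Implicit.
Unset Printing Implicit Defensive.

Local Open Scope classical_set_scope.
Local Open Scope order_scope.

Section OrderIdeals.
Context {d : Order.disp_t} {P : porderType d}.
Implicit Types X Y S : set P.

Definition is_ideal X := forall x y, X x -> y <= x -> X y.

Lemma is_idealI X Y : is_ideal X -> is_ideal Y -> is_ideal (X `&` Y).
Proof. by move=> iX iY x y [Xx Yx] yx; split; [exact: iX yx|exact: iY yx]. Qed.

Lemma is_ideal_down S : is_ideal (down S).
Proof. by move=> x y [s [Ss xs]] yx; exists s; split=> //; exact: Order.POrderTheory.le_trans xs. Qed.

End OrderIdeals.

Record ideal d (P : porderType d) := Ideal {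
  ideal_set :> set P;
  idealP : is_ideal ideal_set }.

Lemma ideal_inj d (P : porderType d) : injective (@ideal_set d P).
Proof.
move=> [X iX] [Y iY] /= XY; subst Y.
by rewrite (Prop_irrelevance iX iY).
Qed.

Section ChoiceFunctions.
Context {d : Order.disp_t} {P : porderType d}.
Implicit Types (f : ideal P -> ideal P) (A B X : ideal P).

Definition choice_function f := forall X, f X `<=` X.

Definition heredity f := forall A B, A `<=` B -> f B `&` A `<=` f A.

Definition outcast f := forall A B, f B `<=` A -> A `<=` B -> f A = f B.

Definition conservative f := [/\ choice_function f, heredity f & outcast f].

End ChoiceFunctions.

Section ElementaryChoiceFunction.
Context {d : Order.disp_t} {P : porderType d}.
(* [prec] is the reflexive order of the index set. *)
Context {I : Type} {prec : rel I} (wo : well_order prec) (a : I -> P).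
Implicit Types X : ideal P.

Definition hits X : {pred I} := [pred i | `[< (X : set P) (a i) >]].

(* [down S] is the ideal generated by [S]. [wo] gives [exists! i, minimum_of
   prec (hits X) i], from which [cid] extracts the least index. *)
Definition first_hit X (h : nonempty (hits X)) : I :=
  projT1 (cid (wo h)).

Definition elementary_gen X : set P :=
  match pselect (nonempty (hits X)) with
  | left h => down [set a j | j in [set j | prec j (first_hit h)]]
  | right _ => down (range a)
  end.

Lemma is_ideal_elementary X : is_ideal (X `&` elementary_gen X).
Proof.
apply: is_idealI; first exact: idealP.
by rewrite /elementary_gen; case: pselect => *; exact: is_ideal_down.
Qed.

Definition elementary_cf X : ideal P := Ideal (@is_ideal_elementary X).

End ElementaryChoiceFunction.

(* Main.v *)
Require Import Defs.
From mathcomp Require Import all_boot all_order.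
From mathcomp Require Import boolp classical_sets wochoice.

(** Whether or not [X] meets the sequence, [elementary_gen wo a X] is the ideal
    generated by the terms whose index is a lower bound of the hits of [X]: the
    lower bounds are the indices up to the first hit if there is one, and all
    indices otherwise ([elementary_genE]).  This removes the case distinction.

    Heredity is then antitonicity: a larger ideal has more hits, hence fewer
    lower bounds.  For outcast, let [f B `<=` A `<=` B].  The term at the first
    hit of [B], if any, is itself chosen from [B], so it lies in [A]; hence the
    hits of [A] and of [B] have the same lower bounds, and [A] and [B] generate
    the same ideal.  Cutting that ideal down to [A] or to [B] makes no
    difference because [f B `<=` A].

    [well_order] only speaks of unique minima, so that [prec] is an order has to
    be recovered from the minima of sets of one, two and three indices. *)

Set Implicit Arguments.
Unset Strict Implicit.
Unset Printing Implicit Defensive.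

Local Open Scope classical_set_scope.
Local Open Scope order_scope.

Section WellOrder.
Context {I : Type} {prec : rel I} (wo : well_order prec).

Lemma well_order_refl i : prec i i.
Proof.
have [|m [[/asboolP mi mini] _]] := wo (A := [pred j | `[< j = i >]]).
  by exists i; apply/asboolP.
by rewrite -{1}mi; apply: mini; apply/asboolP.
Qed.

Lemma well_order_anti i j : prec i j -> prec j i -> i = j.
Proof.
move=> ij ji.
have [|m [_ minU]] := wo (A := [pred k | `[< k = i \/ k = j >]]).
  by exists i; apply/asboolP; left.
transitivity m; [apply: esym|]; apply: minU; split.
- by apply/asboolP; left.
- by move=> k /asboolP[] ->; rewrite ?well_order_refl.
- by apply/asboolP; right.
- by move=> k /asboolP[] ->; rewrite ?well_order_refl.
Qed.

(** The least element [m] of [{i, j, k}] decides: if [m] is [j] then [j] equals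
    [i], and if [m] is [k] then [k] equals [j], by antisymmetry. *)
Lemma well_order_trans i j k : prec i j -> prec j k -> prec i k.
Proof.
move=> ij jk.
have [|m [[/asboolP Am minm] _]] :=
    wo (A := [pred l | `[< [\/ l = i, l = j | l = k] >]]).
  by exists i; apply/asboolP; constructor 1.
have mi : prec m i by apply: minm; apply/asboolP; constructor 1.
have mj : prec m j by apply: minm; apply/asboolP; constructor 2.
have mk : prec m k by apply: minm; apply/asboolP; constructor 3.
case: Am => em; subst m => //.
  by rewrite (well_order_anti ij mi).
by rewrite -(well_order_anti jk mj).
Qed.

End WellOrder.

Section ElementaryIsConservative.
Context {d : Order.disp_t} {P : porderType d}.
Context {I : Type} {prec : rel I} (wo : well_order prec) (a : I -> P).
Implicit Types X A B : ideal P.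

Definition before_hits X (j : I) := forall i, (X : set P) (a i) -> prec j i.

Lemma before_hitsS A B : A `<=` B -> before_hits B `<=` before_hits A.
Proof. by move=> AB j jB i Ai; apply: jB; exact: AB. Qed.

Lemma first_hitP X (h : nonempty (hits a X)) :
  (X : set P) (a (first_hit wo h)) /\ before_hits X (first_hit wo h).
Proof.
rewrite /first_hit; case: cid => i /= [[/asboolP Xi mini] _].
by split=> // k Xk; apply: mini; apply/asboolP.
Qed.

(** By transitivity, an index up to the first hit is below all hits; when there
    are no hits, every index is vacuously below all of them. *)
Lemma elementary_genE X :
  elementary_gen wo a X = down [set a j | j in before_hits X].
Proof.
rewrite /elementary_gen; case: pselect => [h|nh]; congr (down (_ @` _)).
  have [Xh minh] := first_hitP h.
  apply/seteqP; split=> [j jh i Xi|j jX]; last exact: jX.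
  by apply: (well_order_trans wo) jh _; exact: minh.
apply/seteqP; split=> // j _ i Xi; case: nh.
by exists i; apply/asboolP.
Qed.

Lemma elementary_genS A B :
  A `<=` B -> elementary_gen wo a B `<=` elementary_gen wo a A.
Proof.
move=> AB x; rewrite !elementary_genE => -[_ [[j jB <-] xj]].
by exists (a j); split=> //; exists j => //; exact: before_hitsS jB.
Qed.

(** The first hit of [B] indexes a term chosen from [B], so it is also a hit of
    [A]; every index below the hits of [A] is thus below all the hits of [B]. *)
Lemma before_hits_outcast A B :
  elementary_cf wo a B `<=` A -> A `<=` B -> before_hits A = before_hits B.
Proof.
move=> fBA AB; apply/seteqP; split; last exact: before_hitsS.
move=> j jA i Bi.
have h : nonempty (hits a B) by exists i; apply/asboolP.
have [Bh minh] := first_hitP h.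
have Ah : (A : set P) (a (first_hit wo h)).
  apply: fBA; split=> //; rewrite elementary_genE.
  by exists (a (first_hit wo h)); split=> //; exists (first_hit wo h).
by apply: (well_order_trans wo) (jA _ Ah) _; exact: minh.
Qed.

End ElementaryIsConservative.

Theorem mainTheorem3 (d : Order.disp_t) (P : porderType d)
    (I : Type) (prec : rel I) (wo : well_order prec) (a : I -> P) :
  conservative (elementary_cf wo a).
Proof.
split.
- by move=> X x [].
- by move=> A B AB x [[_ gBx] Ax]; split=> //; exact: elementary_genS gBx.
- move=> A B fBA AB.
  have gAB : elementary_gen wo a A = elementary_gen wo a B.
    by rewrite !elementary_genE (before_hits_outcast fBA AB).
  apply: ideal_inj; apply/seteqP; split=> x.
    by move=> [Ax gAx]; split; [exact: AB|rewrite -gAB].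
  by move=> fBx; split; [exact: fBA|rewrite gAB; case: fBx].
Qed.
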